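(* Let $x$ and $q$ be random variables with values in $\mathbb{R}^n$ and $\mathbb{R}^m$, with distributions $\mu_x$ and $\mu_q$, let $\mathcal{P}_1,\dots,\mathcal{P}_\ell:\mathbb{R}^n\times\mathbb{R}^m\to\mathbb{R}$ be polynomials and $l_j,u_j\in\mathbb{R}$, and let $\mathbf{P^*_{risk}}=\mathrm{Prob}_{\mu_x,\mu_q}\{l_j\le\mathcal{P}_j(x,q)\le u_j,\ j=1,\dots,\ell\}$. Define the random vector $Z=[z_1,\dots,z_\ell]$ with $z_j=\mathcal{P}_j(x,q)$. For $j=1,\dots,\ell$ and $d\in\mathbb{N}$, let $\mathcal{K}_j=[l_j,u_j]$ and let $\mathcal{P}_{\mathcal{K}_j}\in\mathbb{R}_d[z_j]$ be a univariate polynomial that is an optimal solution of $$\min_{P\in\mathbb{R}_d[z_j]}\int_{-1}^{1}P(z_j)\,dz_j\quad\text{s.t. }P\ge 1\text{ on }\mathcal{K}_j,\quad P\ge 0\text{ on }[-1,1].$$ Then $$\mathbf{P^*_{risk}}\ \le\ E\Bigl[\prod_{j=1}^{\ell}\mathcal{P}_{\mathcal{K}_j}(z_j)\Bigr].$$ Moreover, writing $\prod_{j=1}^{\ell}\mathcal{P}_{\mathcal{K}_j}(z_j)=\sum_{i_1,\dots,i_\ell}c_{T_{i_1,\dots,i_\ell}}T_{i_1}(z_1)\cdots T_{i_\ell}(z_\ell)$ in the Chebyshev basis, $$\mathbf{P^*_{risk}}\ \le\ \sum_{i_1,\dots,i_\ell}c_{T_{i_1,\dots,i_\ell}}\,m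^Z_{T_{i_1,\dots,i_\ell}}.$$
   Context: $\mathbb{R}_d[z_j]$ is the set of real univariate polynomials of degree at most $d$. $T_i(z)=\cos(i\cos^{-1}z)$, $z\in[-1,1]$, is the Chebyshev polynomial of the first kind of degree $i$, and $m^Z_{T_{i_1,\dots,i_\ell}}=E[T_{i_1}(z_1)\cdots T_{i_\ell}(z_\ell)]$. The joint distribution of $(x,q)$ is the product $\mu_x\mu_q$. Standing assumptions: the set $\{(x,q)\in\mathbb{R}^n\times\mathbb{R}^m: l_j\le\mathcal{P}_j(x,q)\le u_j,\ j=1,\dots,\ell\}$ is compact and contained in $\mathcal{B}=[-1,1]^n\times[-1,1]^m$; $\mathrm{supp}(\mu_x)\subset[-1,1]^n$ and $\mathrm{supp}(\mu_q)\subset[-1,1]^m$; $-1\le\mathcal{P}_j(x,q)\le 1$ on $\mathcal{B}$ and $-1\le l_j,u_j\le 1$ for all $j$ (so that each $z_j$ is supported on $[-1,1]$). *)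

(* Defs.v *)
From HB Require Import structures.
From mathcomp Require Import all_boot all_order all_algebra.
From mathcomp Require Import all_classical all_reals all_analysis.
(* not imported: its notations clash with those of the analysis library *)
From mathcomp Require mpoly.

Set Implicit Arguments.
Unset Strict Implicit.
Unset Printing Implicit Defensive.

Import Order.TTheory GRing.Theory Num.Theory.
Import numFieldNormedType.Exports.

Local Open Scope classical_set_scope.
Local Open Scope ring_scope.

(* R^n carries the Borel sigma-algebra of its usual topology. *)
HB.instance Definition _ (R : realType) (n : nat) :=
  @isMeasurable.Build (sigma_display (@open 'rV[R]_n)) 'rV[R]_n
    <<s @open 'rV[R]_n >> (@sigma_algebra0 _ setT _) (@sigma_algebraC _ _)
    (@sigma_algebra_bigcup _ setT _).

Definition cube (R : realType) (n : nat) : set 'rV[R]_n :=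
  [set v | forall i, -1 <= v ord0 i <= 1].
Arguments cube : clear implicits.

(* The support of a Borel measure: complement of the union of the open null
   sets. *)
Definition msupp (T : topologicalType) (R : realType) (mu : set T -> \bar R) :
    set T :=
  [set t | forall U : set T, open U -> U t -> (0 < mu U)%E].

(* The value at v in R^n x R^m of a polynomial in n + m variables: the first n
   variables are the coordinates of v.1, the last m those of v.2. *)
Definition eval2 (R : realType) (n m : nat) (p : mpoly.mpoly (n + m) R)
    (v : 'rV[R]_n * 'rV[R]_m) : R :=
  mpoly.meval (fun i => row_mx v.1 v.2 ord0 i) p.

Definition constraint_set (R : realType) (n m ell : nat)
    (p : 'I_ell -> mpoly.mpoly (n + m) R) (l u : 'I_ell -> R) :
    set ('rV[R]_n * 'rV[R]_m) :=
  [set v | forall j, l j <= eval2 (p j) v <= u j].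

Definition feasible (R : realType) (d : nat) (K : set R) (p : {poly R}) : Prop :=
  [/\ (size p <= d.+1)%N,
      forall z, K z -> 1 <= p.[z] &
      forall z, -1 <= z <= 1 -> 0 <= p.[z]].

Definition objective (R : realType) (p : {poly R}) : R :=
  \int[lebesgue_measure]_(z in `[-1, 1]) p.[z].

Definition optimal (R : realType) (d : nat) (K : set R) (p : {poly R}) : Prop :=
  feasible d K p /\ forall p', feasible d K p' -> objective p <= objective p'.

(* Meaningful for z in [-1, 1] only. *)
Definition chebT (R : realType) (i : nat) (z : R) : R := cos (i%:R * acos z).

Definition chebT_prod (R : realType) (d ell : nat) (i : 'I_d.+1 ^ ell)
    (z : 'I_ell -> R) : R :=
  \prod_(j < ell) chebT (i j) (z j).

(* c is the family of Chebyshev coefficients of prod_j (pK j)(z_j); as each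
   factor has degree at most d, so have the indices i_j. An identity between
   polynomials holds as soon as it does on [-1, 1]^ell, the domain of chebT. *)
Definition cheb_expansion (R : realType) (d ell : nat) (pK : 'I_ell -> {poly R})
    (c : 'I_d.+1 ^ ell -> R) : Prop :=
  forall z : 'I_ell -> R, (forall j, -1 <= z j <= 1) ->
    \prod_(j < ell) (pK j).[z j] = \sum_i c i * chebT_prod i z.

(* Main.v *)
Require Import Defs.
From mathcomp Require Import all_boot all_order all_algebra.
From mathcomp Require Import all_classical all_reals all_analysis.
From mathcomp Require Import measurable_realfun.
From mathcomp Require mpoly.

Import Order.TTheory GRing.Theory Num.Theory.
Import numFieldNormedType.Exports.

Local Open Scope classical_set_scope.
Local Open Scope ring_scope.

(** The bound is the indicator trick. A feasible [pK j] dominates the indicator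
    function of [[l j, u j]] on [[-1, 1]], and it is nonnegative there.
    Almost surely every [Z j] lies in [[-1, 1]]: the supports of [x] and [q] lie
    in the cubes, so [x] and [q] lie in the cubes almost surely, and the
    polynomials are bounded by 1 there. Hence [\prod_j (pK j).[Z j]] is almost
    surely nonnegative, and at least 1 when all the constraints hold. Taking
    expectations gives the first inequality ([probability_le_expectation]).

    The step from supports to almost sure statements is a Lindelof argument
    ([negligible_off_msupp]): an open subset of R^n is a countable union of
    compact sets, and a compact set that misses the support is covered by
    finitely many open null sets.

    For the Chebyshev form, the recurrence
    [z * T_(i+1) = (T_(i+2) + T_i) / 2] shows that multiplication by [z] raises
    the Chebyshev degree by at most one; so every polynomial of degree at most
    [d] is a combination of [T_0, ..., T_d] on [[-1, 1]] ([cheb_span_horner]), and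
    expanding the product over [j] gives the multivariate coefficients. Any
    such expansion agrees almost surely with the product evaluated at [Z], and
    each term is bounded, so its expectation is computed term by term
    ([expectation_cheb_sum]). As [chebT] is only meaningful on [[-1, 1]],
    equalities of integrands hold almost surely only, and both sides have to be
    measurable on the whole space; this is why [acos] is studied outside of
    [[-1, 1]]. *)

Set Implicit Arguments.
Unset Strict Implicit.
Unset Printing Implicit Defensive.

(** * Chebyshev expansions of polynomials *)

Definition cheb_span (R : realType) (N : nat) (f : R -> R) : Prop :=
  exists a : nat -> R, forall z, -1 <= z <= 1 ->
    f z = \sum_(i < N) a i * chebT i z.

Lemma cheb_span_ext (R : realType) (N : nat) (f g : R -> R) :
  (forall z, -1 <= z <= 1 -> f z = g z) -> cheb_span N f -> cheb_span N g.
Proof. by move=> fg [a fa]; exists a => z zI; rewrite -fg ?fa. Qed.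

Lemma cheb_spanD (R : realType) (N : nat) (f g : R -> R) :
  cheb_span N f -> cheb_span N g -> cheb_span N (fun z => f z + g z).
Proof.
move=> [a fa] [b gb]; exists (fun i => a i + b i) => z zI.
by rewrite fa ?gb// -big_split; apply: eq_bigr => i _; rewrite mulrDl.
Qed.

Lemma cheb_spanZ (R : realType) (N : nat) (k : R) (f : R -> R) :
  cheb_span N f -> cheb_span N (fun z => k * f z).
Proof.
move=> [a fa]; exists (fun i => k * a i) => z zI.
by rewrite fa// mulr_sumr; apply: eq_bigr => i _; rewrite mulrA.
Qed.

Lemma cheb_span_sum (R : realType) (N n : nat) (f : 'I_n -> R -> R) :
  (forall i, cheb_span N (f i)) -> cheb_span N (fun z => \sum_i f i z).
Proof.
elim: n f => [|n IHn] f sf.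
  exists (fun=> 0) => z _.
  by rewrite big_ord0 big1// => i _; rewrite mul0r.
apply: (@cheb_span_ext _ _ (fun z => f ord0 z + \sum_(i < n) f (lift ord0 i) z)).
  by move=> z _; rewrite big_ord_recl.
by apply: cheb_spanD => //; exact: IHn.
Qed.

Lemma cheb_spanT (R : realType) (N i : nat) :
  (i < N)%N -> cheb_span N (@chebT R i).
Proof.
move=> iN; exists (fun j => (j == i)%:R) => z _.
rewrite (bigD1 (Ordinal iN))//= eqxx mul1r big1 ?addr0// => j.
by rewrite -val_eqE/= => /negPf ->; rewrite mul0r.
Qed.

Lemma chebT0 (R : realType) (z : R) : chebT 0 z = 1.
Proof. by rewrite /chebT mul0r cos0. Qed.

Lemma chebT1 (R : realType) (z : R) : -1 <= z <= 1 -> chebT 1 z = z.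
Proof. by move=> zI; rewrite /chebT mul1r acosK// in_itv. Qed.

(** This is [2 cos s cos t = cos (s + t) + cos (s - t)] with [s = (i + 1) t] and
    [t = acos z]. *)
Lemma chebT_rec (R : realType) (i : nat) (z : R) : -1 <= z <= 1 ->
  z * chebT i.+1 z = 2^-1 * chebT i.+2 z + 2^-1 * chebT i z.
Proof.
move=> zI; rewrite /chebT; set t := acos z.
have -> : z = cos t by rewrite acosK// in_itv.
have -> : i.+2%:R * t = i.+1%:R * t + t by rewrite -(natr1 i.+1) mulrDl mul1r.
have -> : i%:R * t = i.+1%:R * t - t by rewrite -(natr1 i) mulrDl mul1r addrK.
rewrite cosD cosB -mulrDr addrACA addNr addr0 -mulr2n mulrC.
by rewrite mulrnAr -mulrnAl -[2^-1 *+ 2]mulr_natl mulfV ?mul1r.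
Qed.

(** The recurrence rewrites [z * T_i] for [i > 0], and [z * T_0 = T_1]. *)
Lemma cheb_span_mulX (R : realType) (N : nat) (f : R -> R) :
  cheb_span N f -> cheb_span N.+1 (fun z => z * f z).
Proof.
move=> [a fa].
apply: (@cheb_span_ext _ _ (fun z => \sum_(i < N) a i * (z * chebT i z))).
  by move=> z zI; rewrite fa// mulr_sumr; apply: eq_bigr => i _; rewrite mulrCA.
apply: cheb_span_sum => i; apply: cheb_spanZ.
case: i => -[|i] iN /=.
  apply: (@cheb_span_ext _ _ (chebT 1)); last exact: cheb_spanT.
  by move=> z zI; rewrite chebT1// chebT0 mulr1.
apply: (@cheb_span_ext _ _ (fun z => 2^-1 * chebT i.+2 z + 2^-1 * chebT i z)).
  by move=> z zI; rewrite chebT_rec.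
apply: cheb_spanD; apply: cheb_spanZ; apply: cheb_spanT => //.
by rewrite ltnS ltnW// ltnW.
Qed.

(** Horner's scheme [p = q * 'X + c] reduces the claim to multiplication by [z]. *)
Lemma cheb_span_horner (R : realType) (d : nat) (p : {poly R}) :
  (size p <= d.+1)%N -> cheb_span d.+1 (horner p).
Proof.
have span1 N (c : R) : cheb_span N.+1 (fun=> c).
  apply: (@cheb_span_ext _ _ (fun z => c * chebT 0 z)).
    by move=> z _; rewrite chebT0 mulr1.
  exact/cheb_spanZ/cheb_spanT.
elim: d p => [|d IHd] p.
  move=> /size1_polyC ->; apply: cheb_span_ext (span1 _ p`_0) => z _.
  by rewrite hornerC.
elim/poly_ind: p => [|q c _] sp.
  by apply: cheb_span_ext (span1 _ 0) => z _; rewrite horner0.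
apply: (@cheb_span_ext _ _ (fun z => z * q.[z] + c)).
  by move=> z _; rewrite hornerD hornerMX hornerC mulrC.
apply: cheb_spanD => //; apply/cheb_span_mulX/IHd.
have [->|q0] := eqVneq q 0; first by rewrite size_poly0.
by move: sp; rewrite size_MXaddC (negPf q0).
Qed.

(** Distributing the product of sums makes the coefficient at a multi-index the
    product of the univariate coefficients. *)
Lemma cheb_expansion_exists (R : realType) (d ell : nat)
    (pK : 'I_ell -> {poly R}) :
  (forall j, (size (pK j) <= d.+1)%N) ->
  exists c : 'I_d.+1 ^ ell -> R, cheb_expansion pK c.
Proof.
move=> spK; have /choice[a pKa] j := cheb_span_horner (spK j).
exists (fun i : 'I_d.+1 ^ ell => \prod_j a j (i j)) => z zI.
under eq_bigr do rewrite pKa//.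
rewrite bigA_distr_bigA/=; apply: eq_bigr => i _.
by rewrite -big_split.
Qed.

(** * Measurability *)

(** [acos z] picks a point of a set that is empty for such a [z], and the default
    point of [R] is 0. *)
Lemma acos_outside (R : realType) (z : R) : ~~ (-1 <= z <= 1) -> acos z = 0.
Proof.
move=> zI; rewrite unlock; case: xgetP => // y _ [_ yz].
by move: zI; rewrite -yz cos_geN1 cos_le1.
Qed.

(** Continuous on the open interval, hence measurable on the closed one, and
    constant outside. *)
Lemma measurable_acos (R : realType) : measurable_fun setT (@acos R).
Proof.
rewrite -(setUv `[-1, 1]%classic); apply/measurable_funU => //.
  exact: measurableC.
split.
  apply: (@measurable_fun_itv_cc _ (-1) 1 false true).
  apply: open_continuous_measurable_fun; first exact: interval_open.
  by move=> z; rewrite inE/= in_itv/= => zI; exact: continuous_acos.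
apply: (eq_measurable_fun (cst 0 : R -> R)) => // z.
by rewrite inE/= in_itv/= => /negP zI; rewrite acos_outside.
Qed.

Lemma measurable_chebT (R : realType) (i : nat) :
  measurable_fun setT (@chebT R i).
Proof.
apply: (measurableT_comp (f := cos)).
  by apply: continuous_measurable_fun; exact: continuous_cos.
apply: measurable_funM => //; exact: measurable_acos.
Qed.

Lemma chebT_prod_norm_le1 (R : realType) (d ell : nat) (i : 'I_d.+1 ^ ell)
    (z : 'I_ell -> R) : `|chebT_prod i z| <= 1.
Proof.
rewrite normr_prod; apply: prodr_ile1 => j _.
by rewrite normr_ge0/= ler_norml cos_geN1 cos_le1.
Qed.

(** The Borel sigma-algebra of R is generated by open intervals, whose preimages
    under a continuous map are open. *)
Lemma measurable_coord (R : realType) (n : nat) (i : 'I_n) :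
  measurable_fun setT (fun v : 'rV[R]_n => v ord0 i).
Proof.
apply: (measurability _ (RGenOpens.measurableE R)).
move=> _ [_ [a [b ->]] <-]; rewrite setTI; apply: sub_sigma_algebra.
apply: open_comp; last exact: interval_open.
by move=> v _; exact: coord_continuous.
Qed.

Lemma measurable_eval2 (R : realType) (n m : nat) (p : mpoly.mpoly (n + m) R) :
  measurable_fun setT (@eval2 R n m p).
Proof.
rewrite /eval2; under eq_fun do rewrite mpoly.mevalE.
apply: measurable_sum => k; apply: measurable_funM => //.
apply: measurable_prod => i _; apply: measurable_funX.
case: (split_ordP i) => j ->.
  under eq_fun do rewrite row_mxEl.
  exact: (measurableT_comp (measurable_coord j) measurable_fst).
under eq_fun do rewrite row_mxEr.
exact: (measurableT_comp (measurable_coord j) measurable_snd).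
Qed.

Lemma measurable_constraint_set (R : realType) (n m ell : nat)
    (p : 'I_ell -> mpoly.mpoly (n + m) R) (l u : 'I_ell -> R) :
  measurable (constraint_set p l u).
Proof.
have -> : constraint_set p l u =
    \bigcap_j (eval2 (p j) @^-1` `[l j, u j]%classic).
  by apply/seteqP; split=> [v h j _|v h j]; have := h j; rewrite /= in_itv/=;
    first apply; move=> /(_ I).
apply: fin_bigcap_measurable => // j _.
by rewrite -[X in measurable X]setTI; apply: measurable_eval2.
Qed.

Lemma measurable_chebT_prod (R : realType) (disp : measure_display)
    (T : measurableType disp) (d ell : nat) (i : 'I_d.+1 ^ ell)
    (Z : T -> 'I_ell -> R) :
  (forall j, measurable_fun setT (Z^~ j)) ->
  measurable_fun setT (fun w => chebT_prod i (Z w)).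
Proof.
move=> mZ; apply: measurable_prod => j _.
apply: (measurableT_comp (f := chebT (i j))); last exact: mZ.
exact: measurable_chebT.
Qed.

(** * The support of a Borel measure on R^n *)

(** Every point of [K] has an open null neighborhood, and finitely many of them
    cover [K]. *)
Lemma negligible_compact_off_msupp (R : realType) (n : nat)
    (mu : {measure set 'rV[R]_n -> \bar R}) (K : set 'rV[R]_n) :
  compact K -> K `<=` ~` msupp mu -> mu.-negligible K.
Proof.
rewrite compact_cover => cK Kmu.
have /choice[U KU] (t : 'rV[R]_n) :
    exists U : set 'rV[R]_n, K t -> [/\ open U, U t & mu U = 0%E].
  have [Kt|] := pselect (K t); last by exists set0.
  have /existsNP[U /not_implyP[oU /not_implyP[Ut U0]]] := Kmu t Kt.
  exists U => _; split => //; apply/eqP; rewrite eq_le measure_ge0 andbT.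
  by rewrite leNgt; apply/negP.
have [t /KU[]//|t Kt|D DK KD] := cK 'rV[R]_n K U.
  by exists t => //; have [] := KU t Kt.
apply: negligibleS KD _; rewrite /cover bigcup_fset big_seq.
elim/big_ind: _ => [|A B mA mB|t tD].
- exact: negligible_set0.
- exact: negligibleU.
- have /KU[oU _ U0] : K t by have := DK t tD; rewrite inE.
  by apply/negligibleP => //; exact: sub_sigma_algebra.
Qed.

(** The complement of [C] is exhausted by the compact sets of the vectors of norm
    at most [k] at distance at least [1 / (k + 1)] from [C]. The definition of the
    support does not give this at once: it only provides null neighborhoods of
    points, of which a union may be uncountable. *)
Lemma negligible_off_msupp (R : realType) (n : nat)
    (mu : {measure set 'rV[R]_n -> \bar R}) (C : set 'rV[R]_n) :
  closed C -> msupp mu `<=` C -> mu.-negligible (~` C).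
Proof.
move=> cC muC.
pose F k : set 'rV[R]_n := [set v | `|v| <= k%:R] `&`
  \bigcap_(w in C) [set v | k.+1%:R^-1 <= `|v - w|].
apply: (@negligibleS _ _ _ _ (\bigcup_k F k)); last first.
  apply: negligible_bigcup => k; apply: negligible_compact_off_msupp.
    apply: bounded_closed_compact.
      exists k%:R; split => // M kM v [/= vk _].
      exact: le_trans vk (ltW kM).
    apply: closedI; last apply: closed_bigI => w _.
      apply: (@closed_comp _ _ (fun v : 'rV[R]_n => `|v|) [set r | r <= k%:R]).
        by move=> v _; exact: norm_continuous.
      exact: closed_le.
    apply: (@closed_comp _ _ (fun v : 'rV[R]_n => `|v - w|)
      [set r | k.+1%:R^-1 <= r]); last exact: closed_ge.
    move=> v _; apply: continuous_comp; last exact: norm_continuous.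
    by apply: continuousB; [exact: id|exact: cst_continuous].
  move=> v [_ Fv] /muC/Fv /=.
  by rewrite subrr normr0 leNgt invr_gt0 ltr0n.
move=> v Cv.
have : open_nbhs v (~` C) by split => //; exact: closed_openC.
move=> /open_nbhs_nbhs/nbhs_ballP[e /= e0 eC].
have [N1 N1v] : exists N, `|v| <= N%:R.
  by exists (Num.bound `|v|); rewrite ltW// archi_boundP.
have [N2 N2e] : exists N, e^-1 <= N%:R.
  by exists (Num.bound e^-1); rewrite ltW// archi_boundP// invr_ge0 ltW.
exists (maxn N1 N2) => //; split.
  by rewrite /= (le_trans N1v)// ler_nat leq_maxl.
move=> w Cw /=; rewrite leNgt; apply/negP => vw; apply: eC Cw.
rewrite -ball_normE /=; apply: lt_le_trans vw _.
rewrite invf_ple ?posrE// (le_trans N2e)// ler_nat.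
by rewrite leqW// leq_maxr.
Qed.

Lemma closed_cube (R : realType) (n : nat) : closed (cube R n).
Proof.
have -> : cube R n = \bigcap_i [set v | -1 <= v ord0 i <= 1].
  by apply/seteqP; split=> [v h i _|v h i]; [exact: h|exact: (h i I)].
apply: closed_bigI => i _.
apply: (@closed_comp _ _ (fun v : 'rV[R]_n => v ord0 i) [set r | -1 <= r <= 1]).
  by move=> v _; exact: coord_continuous.
have -> : [set r : R | -1 <= r <= 1] = `[-1, 1]%classic.
  by apply/seteqP; split=> r; rewrite /= in_itv.
exact: interval_closed.
Qed.

Lemma ae_RV_msupp (R : realType) (n : nat)
    (disp : measure_display) (Omega : measurableType disp)
    (Pr : probability Omega R) (x : {RV Pr >-> 'rV[R]_n}) (C : set 'rV[R]_n) :
  closed C -> msupp (distribution Pr x) `<=` C -> {ae Pr, forall w, C (x w)}.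
Proof.
move=> cC /(negligible_off_msupp cC) xC0.
have mC : measurable (~` C).
  by apply: sub_sigma_algebra; exact: closed_openC.
move: xC0 => /(negligibleP _ mC) xC0; apply/negligibleP => //.
by have := measurable_funPT x measurableT _ mC; rewrite setTI.
Qed.

(** * Expectations *)

Lemma expectation_ae (R : realType) (disp : measure_display)
    (T : measurableType disp) (P : probability T R) (f g : T -> R) :
  measurable_fun setT f -> measurable_fun setT g ->
  {ae P, forall w, f w = g w} -> ('E_P[f] = 'E_P[g])%E.
Proof.
move=> mf mg fg; rewrite unlock; apply: ae_eq_integral => //.
- exact/measurable_EFinP.
- exact/measurable_EFinP.
- by apply: filterS fg => w -> _.
Qed.

(** [f] may be negative on a null set, so the comparison with the indicator
    function of [A] goes through the positive part of [f]. *)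
Lemma probability_le_expectation (R : realType) (disp : measure_display)
    (T : measurableType disp) (P : probability T R) (A : set T) (f : T -> R) :
  measurable A -> measurable_fun setT f ->
  {ae P, forall w, 0 <= f w} -> {ae P, forall w, A w -> 1 <= f w} ->
  (P A <= 'E_P[f])%E.
Proof.
move=> mA mf f0 f1; rewrite -expectation_indic//.
have mfp : measurable_fun setT (fun w => Num.max (f w) 0).
  exact: measurable_maxr.
rewrite (@expectation_ae _ _ _ _ f (fun w => Num.max (f w) 0))//; last first.
  by apply: filterS f0 => w fw; rewrite max_l.
apply: expectation_le => // [w|].
  by rewrite le_max lexx orbT.
apply: filterS f1 => w fw; rewrite indicE.
have [/set_mem/fw f1|_] := boolP (w \in A); last by rewrite le_max lexx orbT.
by rewrite le_max f1.
Qed.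

(** Products of cosines are bounded, hence integrable for a probability, and the
    integral is linear. *)
Lemma expectation_cheb_sum (R : realType) (disp : measure_display)
    (T : measurableType disp) (P : probability T R) (d ell : nat)
    (Z : T -> 'I_ell -> R) (c : 'I_d.+1 ^ ell -> R) :
  (forall j, measurable_fun setT (Z^~ j)) ->
  ('E_P[fun w => (\sum_i c i * chebT_prod i (Z w))%R] =
   \sum_i (c i)%:E * 'E_P[fun w => chebT_prod i (Z w)])%E.
Proof.
move=> mZ.
have intT (i : 'I_d.+1 ^ ell) :
    P.-integrable setT (EFin \o (fun w => chebT_prod i (Z w))).
  apply: measurable_bounded_integrable => //.
  - by rewrite -ge0_fin_numE// fin_num_measure.
  - exact: measurable_chebT_prod.
  - exists 1; split => // M M1 w _ /=.
    exact: le_trans (chebT_prod_norm_le1 _ _) (ltW M1).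
rewrite unlock; under eq_integral do rewrite -sumEFin.
rewrite integral_sum//; last first.
  by move=> i; exact: integrableZl (intT i).
apply: eq_bigr => i _; under eq_integral do rewrite EFinM.
exact: integralZl (intT i) (c i).
Qed.

(** * The risk bound *)

Unset Implicit Arguments.
Set Strict Implicit.
Set Printing Implicit Defensive.

Theorem mainTheorem3 (R : realType) (n m ell : nat)
    (disp : measure_display) (Omega : measurableType disp)
    (Pr : probability Omega R)
    (x : {RV Pr >-> 'rV[R]_n}) (q : {RV Pr >-> 'rV[R]_m})
    (p : 'I_ell -> mpoly.mpoly (n + m) R) (l u : 'I_ell -> R)
    (joint : forall A : set ('rV[R]_n * 'rV[R]_m), measurable A ->
      pushforward Pr (fun w => (x w, q w)) A =
      (distribution Pr x \x distribution Pr q)%E A)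
    (compactK : compact (constraint_set p l u))
    (subK : constraint_set p l u `<=` cube R n `*` cube R m)
    (supp_x : msupp (distribution Pr x) `<=` cube R n)
    (supp_q : msupp (distribution Pr q) `<=` cube R m)
    (p_bound : forall j v, (cube R n `*` cube R m) v ->
      -1 <= eval2 (p j) v <= 1)
    (l_bound : forall j, -1 <= l j <= 1)
    (u_bound : forall j, -1 <= u j <= 1)
    (d : nat) (pK : 'I_ell -> {poly R})
    (pK_opt : forall j, optimal d `[l j, u j]%classic (pK j)) :
  let risk : \bar R :=
    (distribution Pr x \x distribution Pr q)%E (constraint_set p l u) in
  let Z := fun (w : Omega) (j : 'I_ell) => eval2 (p j) (x w, q w) in
  [/\ (risk <= 'E_Pr[fun w => (\prod_(j < ell) (pK j).[Z w j])%R])%E,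
      exists c : 'I_d.+1 ^ ell -> R, cheb_expansion pK c &
      forall c : 'I_d.+1 ^ ell -> R, cheb_expansion pK c ->
        (risk <= \sum_i (c i)%:E * 'E_Pr[fun w => chebT_prod i (Z w)])%E].
Proof.
move=> risk Z.
have pK_feas j : feasible d `[l j, u j]%classic (pK j) by have [] := pK_opt j.
have mxq : measurable_fun setT (fun w => (x w, q w)).
  by apply: measurable_fun_pair; exact: measurable_funPT.
have mZ j : measurable_fun setT (Z^~ j).
  by apply: (measurableT_comp (f := eval2 (p j))) => //; exact: measurable_eval2.
have mf : measurable_fun setT (fun w => \prod_(j < ell) (pK j).[Z w j]).
  apply: measurable_prod => j _.
  by apply: (measurableT_comp (f := horner (pK j))) => //; exact: measurable_poly.
have Z_bound : {ae Pr, forall w, forall j, -1 <= Z w j <= 1}.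
  have := ae_RV_msupp (closed_cube (n := n)) supp_x.
  apply: filterS2 (ae_RV_msupp (closed_cube (n := m)) supp_q) => w qw xw j.
  exact: p_bound.
have mK := measurable_constraint_set p l u.
have riskE : risk = Pr [set w | constraint_set p l u (x w, q w)].
  by rewrite /risk -joint.
have bound : (risk <= 'E_Pr[fun w => (\prod_(j < ell) (pK j).[Z w j])%R])%E.
  rewrite riskE; apply: probability_le_expectation => //.
  - by rewrite -[X in measurable X]setTI; exact: mxq.
  - apply: filterS Z_bound => w Zw; apply: prodr_ge0 => j _.
    by have [_ _] := pK_feas j; apply.
  - apply: aeW => w Kw.
    apply: (@le_trans _ _ (\prod_(j < ell) 1)); first by rewrite big1_eq.
    apply: ler_prod => j _; rewrite ler01/=.
    have [_ + _] := pK_feas j; apply.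
    by rewrite /= in_itv/=; exact: Kw.
split => //.
  by apply: cheb_expansion_exists => j; have [] := pK_feas j.
move=> c pKc; rewrite -expectation_cheb_sum//.
have mS : measurable_fun setT (fun w => \sum_i c i * chebT_prod i (Z w)).
  apply: measurable_sum => i; apply: measurable_funM => //.
  exact: measurable_chebT_prod.
suff <- : ('E_Pr[fun w => (\prod_(j < ell) (pK j).[Z w j])%R] =
    'E_Pr[fun w => (\sum_i c i * chebT_prod i (Z w))%R])%E by [].
by apply: expectation_ae => //; apply: filterS Z_bound => w; exact: pKc.
Qed.
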